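(* Let the predicted multi-target density be $\pi_{k+1|k}(\{x_1,\dots,x_n\})=\rho(n)\,n!\prod_{i=1}^n\pi(x_i)$ with single-target density $\pi$ on $\mathbb{R}^4$ and prior cardinality distribution $\rho$ that is Poisson with parameter $\lambda$, and let $v_{k+1|k}(x)=\lambda\pi(x)$ be its intensity function. Let the array of amplitude measurements $Z_{k+1}$ have the separable multi-target likelihood $g(Z_{k+1}|X)=g(Z_{k+1}|\mathcal{H}_0)\prod_{x\in X}\mathbb{L}(Z_{k+1}|x)$ for finite sets $X\subset\mathbb{R}^4$, where $\mathbb{L}$ is the single-target likelihood ratio. Then the updated cardinality distribution, i.e. the cardinality distribution of the Bayes posterior $\pi_{k+1}$ of the multi-target random finite set $\Xi_{k+1}$, is, for every $n\ge 0$, $$\rho_{|\Xi_{k+1}|}(n)=\exp\left(-\left\langle \mathbb{L}(Z_{k+1}|\cdot),v_{k+1|k}(\cdot)\right\rangle\right)\frac{\left\langle \mathbb{L}(Z_{k+1}|\cdot),v_{k+1|k}(\cdot)\right\rangle^n}{n!}.$$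
   Context: Notation: $\langle f,h\rangle=\int_{\mathbb{R}^4} f(x)h(x)\,dx$. Set integral: for a real-valued function $f$ of finite subsets of $\mathbb{R}^4$, $\int f(X)\,\delta X=\sum_{n=0}^\infty \frac{1}{n!}\int_{(\mathbb{R}^4)^n} f(\{x_1,\dots,x_n\})\,dx_1\cdots dx_n$, the $n=0$ term being $f(\emptyset)$. Prior: Poisson cardinality means $\rho(n)=e^{-\lambda}\lambda^n/n!$ with $0<\lambda<\infty$. Posterior: by Bayes' rule, $\pi_{k+1}(X)=g(Z_{k+1}|X)\,\pi_{k+1|k}(X)\big/\int g(Z_{k+1}|Y)\,\pi_{k+1|k}(Y)\,\delta Y$, and its cardinality distribution is $\rho_{|\Xi_{k+1}|}(n)=\frac{1}{n!}\int_{(\mathbb{R}^4)^n}\pi_{k+1}(\{x_1,\dots,x_n\})\,dx_1\cdots dx_n$ (equal to $\pi_{k+1}(\emptyset)$ for $n=0$). Measurement model (amplitude echo model): there are $m$ pixels and the measurement $Z_{k+1}$ supplies an amplitude $A_{k+1}^{(i)}$ for each pixel $i=1,\dots,m$. For a target state $x\in\mathbb{R}^4$, $T(x)\subseteq\{1,\dots,m\}$ is the set of pixels illuminated by $x$. The likelihood of the amplitude in pixel $i$ is $g(A_{k+1}^{(i)}|x,\mathcal{H}_1)$ if the pixel is illuminated by $x$, and $g(A_{k+1}^{(i)}|\mathcal{H}_0)$ (assumed positive) if it is not illuminated by a target. The likelihood ratio of target $x$ is $$\mathbb{L}(Z_{k+1}|x)=\prod_{i\in T(x)}\frac{g(A_{k+1}^{(i)}|x,\mathcal{H}_1)}{g(A_{k+1}^{(i)}|\mathcal{H}_0)},$$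 and the noise-only likelihood is $g(Z_{k+1}|\mathcal{H}_0)=\prod_{i=1}^m g(A_{k+1}^{(i)}|\mathcal{H}_0)$. Separable likelihood: pixel amplitudes are conditionally independent given the targets and distinct targets are assumed to illuminate disjoint sets of pixels, so the multi-target likelihood is $$g(Z_{k+1}|X)=\Big(\prod_{x\in X}\prod_{i\in T(x)}g(A_{k+1}^{(i)}|x,\mathcal{H}_1)\Big)\Big(\prod_{i\notin\bigcup_{x\in X}T(x)}g(A_{k+1}^{(i)}|\mathcal{H}_0)\Big)=g(Z_{k+1}|\mathcal{H}_0)\prod_{x\in X}\mathbb{L}(Z_{k+1}|x).$$ The final product form is taken as the multi-target likelihood for all finite sets $X$ (including $g(Z_{k+1}|\emptyset)=g(Z_{k+1}|\mathcal{H}_0)$). All functions are measurable and nonnegative, and the Bayes update is assumed well defined, i.e. $\langle \mathbb{L}(Z_{k+1}|\cdot),v_{k+1|k}\rangle<\infty$. The convention $0^0=1$ is used. *)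

(* Defs.v *)
From HB Require Import structures.
From mathcomp Require Import all_boot all_order all_algebra finmap.
From mathcomp Require Import all_classical all_reals all_analysis.

Set Implicit Arguments.
Unset Strict Implicit.
Unset Printing Implicit Defensive.

Import Order.TTheory GRing.Theory Num.Theory.

Local Open Scope classical_set_scope.
Local Open Scope ring_scope.

Section power_measure.
Context d (T : measurableType d) (R : realType).

Definition tcons n (p : T * n.-tuple T) : n.+1.-tuple T :=
  [tuple of p.1 :: p.2].

Lemma measurable_tcons n : measurable_fun [set: T * n.-tuple T] (@tcons n).
Proof. exact: measurable_cons. Qed.

Definition cons_measure (mu : {sigma_finite_measure set T -> \bar R}) n
    (nu : {sigma_finite_measure set (n.-tuple T) -> \bar R}) :
    set (n.+1.-tuple T) -> \bar R :=
  pushforward (mu \x nu)%E (@tcons n).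

Section cons_measure.
Variables (mu : {sigma_finite_measure set T -> \bar R}) (n : nat)
  (nu : {sigma_finite_measure set (n.-tuple T) -> \bar R}).

Let M : {measure set (n.+1.-tuple T) -> \bar R} :=
  measure_function_pushforward__canonical__measure_function_Measure
    (mu \x nu)%E (@measurable_tcons n).

Let cons_measure0 : cons_measure mu nu set0 = 0%E.
Proof. exact: (measure0 M). Qed.

Let cons_measure_ge0 A : (0 <= cons_measure mu nu A)%E.
Proof. exact: (measure_ge0 M). Qed.

Let cons_measure_sigma_additive : semi_sigma_additive (cons_measure mu nu).
Proof. exact: (@measure_semi_sigma_additive _ _ _ M). Qed.

HB.instance Definition _ := isMeasure.Build _ _ _ (cons_measure mu nu)
  cons_measure0 cons_measure_ge0 cons_measure_sigma_additive.

Let cons_measure_sigma_finite : sigma_finite setT (cons_measure mu nu).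
Proof.
have /sigma_finiteP[F [FT ndF Foo]] := sigma_finiteT mu.
have /sigma_finiteP[G [GT ndG Goo]] := sigma_finiteT nu.
pose hd (t : n.+1.-tuple T) := tnth t ord0.
pose tl (t : n.+1.-tuple T) : n.-tuple T := [tuple of behead t].
have mhd : measurable_fun setT hd by exact: measurable_tnth.
have mtl : measurable_fun setT tl by exact: measurable_behead.
exists (fun k => hd @^-1` F k `&` tl @^-1` G k) => [|k].
  apply/seteqP; split=> // t _.
  have [i _ Fi] : (\bigcup_i F i) (hd t) by rewrite -FT.
  have [j _ Gj] : (\bigcup_i G i) (tl t) by rewrite -GT.
  exists (maxn i j) => //; split=> /=.
    by move: (hd t) Fi; exact/subsetPset/ndF/leq_maxl.
  by move: (tl t) Gj; exact/subsetPset/ndG/leq_maxr.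
have [mF Fk] := Foo k; have [mG Gk] := Goo k; split.
  by apply: measurableI; rewrite -[X in measurable X]setTI;
    [exact: mhd|exact: mtl].
rewrite /cons_measure /pushforward.
rewrite (_ : _ @^-1` _ = F k `*` G k); last first.
  have tlK (q : T * n.-tuple T) : tl (tcons q) = q.2 by exact: val_inj.
  by apply/seteqP; split=> q /=; rewrite tlK.
by rewrite product_measure1E// lte_mul_pinfty// ge0_fin_numE.
Qed.

HB.instance Definition _ := Measure_isSigmaFinite.Build _ _ _
  (cons_measure mu nu) cons_measure_sigma_finite.

End cons_measure.

(* The product measure mu^n on T^n; on T^0, a single point, it is the unit
   mass. *)
Fixpoint power_measure (mu : {sigma_finite_measure set T -> \bar R}) n :
    {sigma_finite_measure set (n.-tuple T) -> \bar R} :=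
  if n is k.+1 then cons_measure mu (power_measure mu k)
  else dirac ([tuple] : 0.-tuple T).

End power_measure.

(* The state space R^4, with the product of the Borel sigma-algebras. *)
Notation state R := (4.-tuple (measurableTypeR R)).

Definition lebesgue_measure4 (R : realType) :
    {sigma_finite_measure set (state R) -> \bar R} :=
  power_measure (@lebesgue_measure R) 4.

(* Functions of finite sets are functions on {fset T}.  A tuple with a repeated
   entry yields a finite set of smaller cardinality; for a diffuse mu, such as
   Lebesgue measure on R^4, these tuples form a null set of mu^n. *)
Section random_finite_sets.
Context d (T : measurableType d) (R : realType).
Variable mu : {sigma_finite_measure set T -> \bar R}.

Definition dotp (f h : T -> R) : \bar R := \int[mu]_x (f x * h x)%:E.

Definition set_integral_term (f : {fset T} -> R) (n : nat) : \bar R :=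
  ((n`!%:R^-1)%:E *
   \int[power_measure mu n]_t (f [fset x in tval t]%fset)%:E)%E.

Definition set_integral (f : {fset T} -> R) : \bar R :=
  (\sum_(0 <= n <oo) set_integral_term f n)%E.

Definition cardinality_distribution (f : {fset T} -> R) (n : nat) : \bar R :=
  set_integral_term f n.

Definition iid_cluster_density (rho : nat -> R) (p : T -> R) (X : {fset T}) : R :=
  rho #|` X|%fset * (#|` X|%fset)`!%:R * \prod_(x <- X) p x.

(* fine only matters when the evidence is infinite, i.e. when the Bayes update
   is not well defined. *)
Definition bayes_posterior (g prior : {fset T} -> R) (X : {fset T}) : R :=
  g X * prior X / fine (set_integral (fun Y => g Y * prior Y)).

End random_finite_sets.

(* Z i is the amplitude in pixel i, g1 i a x the likelihood of amplitude a in
   pixel i when it is illuminated by a target in state x, g0 i a the one when it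
   is not illuminated, and illum x the set of pixels illuminated by x. *)
Section amplitude_echo_model.
Context (R : realType) (S : choiceType) (m : nat).
Variables (illum : S -> {set 'I_m}) (g1 : 'I_m -> R -> S -> R)
  (g0 : 'I_m -> R -> R) (Z : 'I_m -> R).

Definition likelihood_ratio (x : S) : R :=
  \prod_(i in illum x) (g1 i (Z i) x / g0 i (Z i)).

Definition noise_likelihood : R := \prod_(i < m) g0 i (Z i).

Definition multitarget_likelihood (X : {fset S}) : R :=
  noise_likelihood * \prod_(x <- X) likelihood_ratio x.

End amplitude_echo_model.

(* Main.v *)
Require Import Defs.
From mathcomp Require Import all_boot all_order all_algebra finmap.
From mathcomp Require Import all_classical all_reals all_analysis measurable_realfun.
From mathcomp Require Import ring.

Set Implicit Arguments.
Unset Strict Implicit.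
Unset Printing Implicit Defensive.

Import Order.TTheory GRing.Theory Num.Theory.

Local Open Scope classical_set_scope.
Local Open Scope ring_scope.

(* With a Poisson prior, rho(n) n! = exp(-lambda) lambda^n, so the joint density
   g(Z|X) prior(X) is a constant times prod_(x in X) L(x) v(x).  The n-th term of
   the set integral of such a product is <L, v>^n / n! by Tonelli's theorem, hence
   the evidence is an exponential series and the constant cancels in the
   posterior.  On a tuple with repeated entries the product over the finite set
   differs from the product over the tuple; as Lebesgue measure on R^4 has no
   atoms and a measurable diagonal, these tuples form a null set. *)

(** * Almost everywhere comparison of integrals *)

Section ae_integral.
Context d (T : measurableType d) (R : realType).
Variable mu : {measure set T -> \bar R}.
Local Open Scope ereal_scope.
Import HBNNSimple.

(* The integral of a nonnegative function is a supremum over simple functions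
   whether or not it is measurable. *)
Lemma ge0_ae_le_integral_nonmeasurable (f g : T -> \bar R) :
  (forall x, 0 <= f x) -> (forall x, 0 <= g x) ->
  {ae mu, forall x, f x <= g x} ->
  \int[mu]_x f x <= \int[mu]_x g x.
Proof.
move=> f0 g0 [N [mN N0 fgN]].
rewrite !ge0_integralTE//; apply: ge_ereal_sup => _ [h hf <-].
(* Setting [h] to zero on the null set [N] keeps its integral and puts it below [g] everywhere. *)
have mNC := measurableC mN.
pose h' : {nnsfun T >-> R} := proj_nnsfun h mNC.
have h'E x : h' x = (h x * \1_(~` N) x)%R by [].
have -> : sintegral mu h = sintegral mu h'.
  rewrite -!integralT_nnsfun; apply: ge0_ae_eq_integral => //.
  - exact/measurable_EFinP.
  - exact/measurable_EFinP.
  - by move=> x _; rewrite lee_fin.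
  - by move=> x _; rewrite lee_fin.
  - exists N; split=> // x hx; apply: contrapT => Nx; apply: hx => _.
    by rewrite h'E indicE mem_set// mulr1.
apply: ereal_sup_ubound; exists h' => // x.
rewrite h'E indicE; have [/set_mem Nx|_] := boolP (x \in ~` N).
  rewrite mulr1 (le_trans (hf x))//; apply: contrapT => fgx.
  exact/Nx/fgN.
by rewrite mulr0.
Qed.

(** Serves integrands, such as a product over [[fset x in tval t]], whose measurability is not
    established. *)
Lemma ge0_ae_eq_integral_nonmeasurable (f g : T -> \bar R) :
  (forall x, 0 <= f x) -> (forall x, 0 <= g x) ->
  {ae mu, forall x, f x = g x} ->
  \int[mu]_x f x = \int[mu]_x g x.
Proof.
move=> f0 g0 fg; apply/eqP; rewrite eq_le.
by apply/andP; split; apply: ge0_ae_le_integral_nonmeasurable => //;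
  apply: filterS fg => x ->.
Qed.

End ae_integral.

(** * Powers of a diffuse measure *)

Section power_measure_theory.
Context d (T : measurableType d) (R : realType).
Variable mu : {sigma_finite_measure set T -> \bar R}.
Hypothesis mdiag : measurable [set xy : T * T | xy.1 = xy.2].

Let meq d' (U : measurableType d') (f g : U -> T) :
  measurable_fun setT f -> measurable_fun setT g ->
  measurable [set u | f u = g u].
Proof.
move=> mf mg; have /(_ measurableT _ mdiag) := measurable_fun_pair mf mg.
by rewrite setTI.
Qed.

Lemma measurable_set1_diagonal (x : T) : measurable [set x].
Proof. by have := meq (@measurable_id _ _ setT) (measurable_cst x). Qed.

(** Carries [mdiag] from [T] to its powers, hence from the real line to the state space. *)
Lemma measurable_diagonal_tuple n :
  measurable [set st : n.-tuple T * n.-tuple T | st.1 = st.2].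
Proof.
rewrite (_ : mkset _ = \bigcap_(i in [set: 'I_n])
    [set st | tnth st.1 i = tnth st.2 i]); last first.
  apply/seteqP; split=> [[s t]/= -> //|[s t]/= st].
  by apply: eq_from_tnth => i; exact: st.
apply: fin_bigcap_measurable => // i _.
by apply: meq; exact: (measurableT_comp (measurable_tnth i)).
Qed.

Lemma measurable_nonuniq n : measurable [set t : n.-tuple T | ~ uniq t].
Proof.
rewrite (_ : mkset _ = \bigcup_(ij in [set ij : 'I_n * 'I_n | ij.1 != ij.2])
    [set t | tnth t ij.1 = tnth t ij.2]); last first.
  apply/seteqP; split=> [t|t [[i j]/= ij tij]].
    apply: contra_notP => tij; apply/tuple_uniqP => i j tE.
    by apply/eqP/negP => /negP ij; apply: tij; exists (i, j).
  by move=> /tuple_uniqP/(_ _ _ tij)/eqP; rewrite (negbTE ij).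
apply: fin_bigcup_measurable => [//|ij _].
by apply: meq; exact: measurable_tnth.
Qed.

Hypothesis mu1 : forall x, mu [set x] = 0%E.

(** A point pulls back along [tcons] to a rectangle whose first side is null, and 0 times infinity
    is 0. The exponent is positive because the single point of the zeroth power has mass one. *)
Lemma power_measure_set1 n (t : n.+1.-tuple T) :
  power_measure mu n.+1 [set t] = 0%E.
Proof.
rewrite /= /cons_measure /pushforward.
have mhd := measurable_set1_diagonal (thead t).
have mtl : measurable [set [tuple of behead t]].
  have /(measurable_ysection [tuple of behead t]) :=
    measurable_diagonal_tuple (n := n).
  by congr measurable; apply/seteqP; split=> s; rewrite /ysection/= inE.
rewrite (_ : _ @^-1` _ = [set thead t] `*` [set [tuple of behead t]]).
  by rewrite product_measure1E// [X in (X * _)%E](mu1 (thead t)) mul0e.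
apply/seteqP; split=> [[x s]/= <-|[x s]/= [-> ->]].
  by rewrite theadE; split=> //; exact/val_inj.
by rewrite /tcons/= -tuple_eta.
Qed.

Lemma negligible_mem (s : seq T) : mu.-negligible [set x | x \in s].
Proof.
elim: s => [|y s IH].
  by rewrite (_ : mkset _ = set0) -?subset0//; exact: negligible_set0.
rewrite (_ : mkset _ = [set y] `|` [set x | x \in s]).
  apply: negligibleU => //; apply/negligibleP; last exact: mu1.
  exact: measurable_set1_diagonal.
apply/seteqP; split=> x /=; rewrite inE.
  by move=> /orP[/eqP|]; [left|right].
by move=> [->|->]; rewrite ?eqxx ?orbT.
Qed.

(** By induction: a head that spoils a duplicate-free tail is one of the finitely many entries of
    that tail, and finite sets are null. *)
Lemma ae_uniq n : {ae power_measure mu n, forall t : n.-tuple T, uniq t}.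
Proof.
elim: n => [|n IH]; first by apply: aeW => t; rewrite tuple0.
apply/negligibleP; first exact: measurable_nonuniq.
rewrite /= /cons_measure /pushforward.
set A := _ @^-1` _.
have mA : measurable A.
  rewrite /A -[X in measurable X]setTI; apply: measurable_tcons => //.
  exact: measurable_nonuniq.
(* Tonelli with the head integrated first: by [IH] it suffices that the inner integral vanishes for
   duplicate-free tails. *)
rewrite -[A]setIT -integral_indic// fubini_tonelli2//; last first.
  exact/measurable_EFinP/measurable_indic.
rewrite -[RHS](integral0 (power_measure mu n) setT).
apply: ge0_ae_eq_integral_nonmeasurable => [t|//|].
  by apply: integral_ge0 => x _; rewrite lee_fin.
apply: filterS IH => t ut; rewrite /fubini_G/=.
rewrite -[RHS](integral0 mu setT).
apply: ge0_ae_eq_integral_nonmeasurable => [x|//|]; first by rewrite lee_fin.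
apply: negligibleS (negligible_mem t) => x /=.
apply: contra_notP => /negP xt; rewrite indicE memNset// /A/=.
by rewrite xt ut.
Qed.

End power_measure_theory.

(** By induction: Tonelli splits off the head, which contributes one factor [c]; on the zeroth power
    the empty product is integrated against a unit mass. *)
Lemma integral_power_measure_prod d (T : measurableType d) (R : realType)
    (mu : {sigma_finite_measure set T -> \bar R}) (q : T -> R) (c : R) n :
  (forall x, 0 <= q x) -> measurable_fun setT q ->
  (\int[mu]_x (q x)%:E = c%:E)%E ->
  (\int[power_measure mu n]_t (\prod_(x <- tval t) q x)%:E = (c ^+ n)%:E)%E.
Proof.
move=> q0 mq qc.
have mP k : measurable_fun setT (fun t : k.-tuple T => (\prod_(x <- t) q x)%:E).
  apply/measurable_EFinP; under eq_fun do rewrite big_tuple.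
  by apply: measurable_prod => i _; apply: measurableT_comp => //; exact: measurable_tnth.
have P0 k (t : k.-tuple T) : (0 <= (\prod_(x <- t) q x)%:E)%E.
  by rewrite lee_fin prodr_ge0.
elim: n => [|n IH].
  rewrite /= integral_dirac//; last exact: mP.
  by rewrite diracT mul1e big_nil expr0.
rewrite /= ge0_integral_pushforward//; [|exact: measurable_tcons|exact: mP].
rewrite preimage_setT fubini_tonelli1//; last 2 first.
- by apply: measurableT_comp; [exact: mP|exact: measurable_tcons].
- by move=> xt; exact: P0.
rewrite /fubini_F /=.
under eq_integral => x _.
  under eq_integral do rewrite big_cons EFinM.
  rewrite ge0_integralZl_EFin//; last exact: mP.
  rewrite IH muleC; over.
rewrite ge0_integralZl_EFin//=.
- by rewrite qc -EFinM exprSr.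
- by move=> x _; rewrite lee_fin.
- exact/measurable_EFinP.
(* The sign of [c ^+ n] is read off from the integral that it equals. *)
- by rewrite -lee_fin -IH; apply: integral_ge0 => t _; exact: P0.
Qed.

(** * Set integrals of multiplicative functions *)

Section set_integral_prod.
Context d (T : measurableType d) (R : realType).
Variable mu : {sigma_finite_measure set T -> \bar R}.
Hypothesis mdiag : measurable [set xy : T * T | xy.1 = xy.2].
Hypothesis mu1 : forall x, mu [set x] = 0%E.
Variables (a : R) (q : T -> R) (c : R).
Hypotheses (a0 : 0 <= a) (q0 : forall x, 0 <= q x).
Hypotheses (mq : measurable_fun setT q) (qc : (\int[mu]_x (q x)%:E = c%:E)%E).

Let F (X : {fset T}) : R := a * \prod_(x <- X) q x.

(** The weight [a] is kept general because the formula serves both the evidence and the normalized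
    posterior. *)
Lemma set_integral_term_prod n :
  set_integral_term mu F n = (a * (c ^+ n / n`!%:R))%:E.
Proof.
rewrite /set_integral_term.
rewrite (@ge0_ae_eq_integral_nonmeasurable _ _ _ _ _
    (fun t => a%:E * (\prod_(x <- tval t) q x)%:E)%E); last 3 first.
- by move=> t; rewrite lee_fin mulr_ge0// prodr_ge0.
- by move=> t; rewrite -EFinM lee_fin mulr_ge0// prodr_ge0.
- apply: filterS (ae_uniq mdiag mu1 n) => t ut.
  rewrite /F EFinM; congr (_ * _%:E)%E.
  (* A duplicate-free tuple enumerates its finite set up to order. *)
  by apply: perm_big; apply: uniq_perm => // x; rewrite !inE.
rewrite ge0_integralZl_EFin//.
- rewrite (integral_power_measure_prod n q0 mq qc) -!EFinM.
  by congr EFin; rewrite mulrC -mulrA.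
- by move=> t _; rewrite lee_fin prodr_ge0.
- apply/measurable_EFinP; under eq_fun do rewrite big_tuple.
  apply: measurable_prod => i _.
  by apply: measurableT_comp => //; exact: measurable_tnth.
Qed.

Lemma set_integral_prod : set_integral mu F = (a * expR c)%:E.
Proof.
have c0 : 0 <= c.
  by rewrite -lee_fin -qc; apply: integral_ge0 => x _; rewrite lee_fin.
rewrite /set_integral; under eq_eseriesr do rewrite set_integral_term_prod EFinM.
rewrite nneseriesZl/=; last first.
  by move=> n _; rewrite lee_fin divr_ge0// exprn_ge0.
rewrite EFinM; congr *%E.
rewrite /expR -EFin_lim; last exact: is_cvg_series_exp_coeff.
by apply/congr_lim/funext => n; rewrite /series/= -sumEFin.
Qed.

End set_integral_prod.

(** * Measurability for the concrete model, and the conclusion *)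

Lemma measurable_diagonal_lebesgue (R : realType) :
  measurable [set xy : measurableTypeR R * measurableTypeR R | xy.1 = xy.2].
Proof.
have := @measurable_fun_eqr _ _ R setT _ _
  (@measurable_fst _ _ (measurableTypeR R) (measurableTypeR R))
  (@measurable_snd _ _ (measurableTypeR R) (measurableTypeR R)).
move=> /(_ measurableT [set true] I); rewrite setTI.
by congr measurable; apply/seteqP; split=> xy /= /eqP.
Qed.

Lemma measurable_likelihood_ratio d (S : measurableType d) (R : realType) m
    (illum : S -> {set 'I_m}) (g1 : 'I_m -> R -> S -> R) (g0 : 'I_m -> R -> R)
    (Z : 'I_m -> R) :
  (forall i, measurable [set x | i \in illum x]) ->
  (forall i, measurable_fun [set: R * S] (fun ax => g1 i ax.1 ax.2)) ->
  measurable_fun setT (likelihood_ratio illum g1 g0 Z).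
Proof.
move=> millum mg1; rewrite /likelihood_ratio.
(* The index set varies with [x]; the product is extended to all pixels, with factor 1 off
   [illum x], so that each factor can be treated separately. *)
under eq_fun do rewrite big_mkcond.
apply: measurable_prod => i _; apply: measurable_fun_ifT => //.
  by apply: (measurable_fun_bool true); rewrite setTI; exact: millum.
apply: measurable_funM => //.
exact: (measurableT_comp (mg1 i) (pair1_measurable (Z i))).
Qed.

Theorem proposition4 (R : realType) (m : nat)
    (illum : state R -> {set 'I_m})
    (g1 : 'I_m -> R -> state R -> R) (g0 : 'I_m -> R -> R)
    (Z : 'I_m -> R)
    (rho : nat -> R) (lambda : R) (p : state R -> R)
    (illum_meas : forall i : 'I_m, measurable [set x | i \in illum x])
    (g1_ge0 : forall i a x, 0 <= g1 i a x)
    (g1_meas : forall i : 'I_m,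
      measurable_fun [set: R * state R]
        (fun ax : R * state R => g1 i ax.1 ax.2))
    (g0_ge0 : forall i a, 0 <= g0 i a)
    (g0_meas : forall i : 'I_m, measurable_fun [set: R] (g0 i))
    (g0_gt0 : forall i : 'I_m, 0 < g0 i (Z i))
    (lambda_gt0 : 0 < lambda)
    (rho_poisson : forall n : nat, rho n = poisson_pmf lambda n)
    (p_ge0 : forall x, 0 <= p x)
    (p_meas : measurable_fun [set: state R] p)
    (p_density : (\int[lebesgue_measure4 R]_x (p x)%:E = 1)%E) :
  let L := likelihood_ratio illum g1 g0 Z in
  let v := fun x => lambda * p x in
  let Lv := dotp (lebesgue_measure4 R) L v in
  let prior := iid_cluster_density rho p in
  let posterior := bayes_posterior (lebesgue_measure4 R)
    (multitarget_likelihood illum g1 g0 Z) prior in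
  (Lv < +oo)%E ->
  forall n : nat,
    cardinality_distribution (lebesgue_measure4 R) posterior n =
    (expR (- fine Lv) * (fine Lv ^+ n / n`!%:R))%:E.
Proof.
move=> L v Lv prior posterior Lvoo n.
have mdiag := measurable_diagonal_tuple (@measurable_diagonal_lebesgue R) (n := 4).
have mu1 : forall x, lebesgue_measure4 R [set x] = 0%E.
  apply: power_measure_set1; first exact: measurable_diagonal_lebesgue.
  exact: lebesgue_measure_set1.
pose q x := L x * v x.
have q0 x : 0 <= q x.
  rewrite mulr_ge0// ?mulr_ge0// ?(ltW lambda_gt0)//.
  by apply: prodr_ge0 => i _; rewrite divr_ge0.
have mq : measurable_fun setT q.
  apply: measurable_funM; first exact: measurable_likelihood_ratio.
  exact: measurable_funM.
(* Finiteness of [Lv] enters here: [fine] then loses nothing. *)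
have qc : (\int[lebesgue_measure4 R]_x (q x)%:E = (fine Lv)%:E)%E.
  rewrite fineK// ge0_fin_numE//.
  by apply: integral_ge0 => x _; rewrite lee_fin; exact: q0.
(* What the joint density keeps outside the product once the factorials cancel and each power of
   [lambda] is absorbed into a factor [v x]. *)
pose a := noise_likelihood g0 Z * expR (- lambda).
have a_gt0 : 0 < a by rewrite mulr_gt0 ?expR_gt0// prodr_gt0.
have jointE X : multitarget_likelihood illum g1 g0 Z X * prior X =
    a * \prod_(x <- X) q x.
  rewrite /multitarget_likelihood /prior /iid_cluster_density rho_poisson.
  rewrite /poisson_pmf lambda_gt0 /q /v !big_split/= big_const_seq count_predT.
  rewrite iter_mulr_1 /a.
  have X0 : (#|` X|)`!%:R != 0 :> R by rewrite pnatr_eq0 -lt0n fact_gt0.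
  by field.
have evE : set_integral (lebesgue_measure4 R)
    (fun Y => multitarget_likelihood illum g1 g0 Z Y * prior Y) =
    (a * expR (fine Lv))%:E.
  by under eq_fun do rewrite jointE; exact: set_integral_prod (ltW a_gt0) q0 mq qc.
have postE : posterior = fun X => expR (- fine Lv) * \prod_(x <- X) q x.
  apply/funext => X; rewrite /posterior /bayes_posterior evE/= jointE expRN.
  by field; rewrite !gt_eqF ?expR_gt0.
(* The posterior is again multiplicative, now with weight [expR (- fine Lv)], so the formula for one
   term applies. *)
rewrite /cardinality_distribution postE.
exact: set_integral_term_prod (expR_ge0 _) q0 mq qc n.
Qed.
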